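(* Let $P$ be a complex polynomial of degree $n\ge 1$, and let $Q$ be a non-constant complex rational function. Let $q_1,q_2,\dots,q_l$ be the multiplicities of the (distinct) poles of $Q$ on the Riemann sphere, and assume that $\gcd(q_1,q_2,\dots,q_l,n)=1$. Then the curve $E_{P,Q}(x,y)=0$ is irreducible over $\mathbb{C}$.
   Context: For non-constant complex rational functions $P$ and $Q$, $E_{P,Q}(x,y)\in\mathbb{C}[x,y]$ denotes the numerator of $P(x)-Q(y)$: writing $P=P_1/P_2$ and $Q=Q_1/Q_2$ with $P_1,P_2$ coprime polynomials and $Q_1,Q_2$ coprime polynomials, $E_{P,Q}(x,y)=P_1(x)Q_2(y)-P_2(x)Q_1(y)$ (well defined up to a nonzero constant factor). Irreducibility of the curve $E_{P,Q}(x,y)=0$ means irreducibility over $\mathbb{C}$ of the polynomial $E_{P,Q}$. Poles of $Q$ are taken on the Riemann sphere $\widehat{\mathbb{C}}=\mathbb{C}\cup\{\infty\}$, so $\infty$ is included if $Q(\infty)=\infty$, and the multiplicity of a pole is the local multiplicity of $Q:\widehat{\mathbb{C}}\to\widehat{\mathbb{C}}$ at that point. *)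

(* Defs.v *)
From mathcomp Require Import all_boot all_order all_algebra.

Set Implicit Arguments.
Unset Strict Implicit.
Unset Printing Implicit Defensive.

Import GRing.Theory.
Local Open Scope ring_scope.

Notation "p %:F" := (FracField.tofrac p) : ring_scope.

Definition irreducible_elt (A : idomainType) (p : A) : Prop :=
  [/\ p != 0, p \isn't a GRing.unit
    & forall a b : A, p = a * b -> a \is a GRing.unit \/ b \is a GRing.unit].

Section RationalFunctions.
Variable F : fieldType.
Local Notation ratfun := {fraction {poly F}}.

(* \n_(repr f) and \d_(repr f) need not be coprime, hence the division by
   their gcd. *)
Definition fnum (f : ratfun) : {poly F} :=
  \n_(repr f) %/ gcdp \n_(repr f) \d_(repr f).

Definition fden (f : ratfun) : {poly F} :=
  \d_(repr f) %/ gcdp \n_(repr f) \d_(repr f).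

Lemma fden_neq0 (f : ratfun) : fden f != 0.
Proof.
rewrite /fden dvdp_div_eq0 ?dvdp_gcdr //; exact: denom_ratioP.
Qed.

Lemma coprime_fnum_fden (f : ratfun) : coprimep (fnum f) (fden f).
Proof.
by apply: coprimep_div_gcd; rewrite denom_ratioP orbT.
Qed.

Lemma fnum_fdenE (f : ratfun) : f = (fnum f)%:F / (fden f)%:F.
Proof.
set n := \n_(repr f); set d := \d_(repr f).
have d0 : d != 0 by exact: denom_ratioP.
have g0 : gcdp n d != 0 by rewrite gcdp_eq0 negb_and d0 orbT.
have dF0 (p : {poly F}) : (p%:F == 0) = (p == 0) by rewrite tofrac_eq0.
have fE : f = n%:F / d%:F.
  rewrite -[LHS]reprK -[repr f]Ratio_numden -/n -/d.
  rewrite !piE /= /FracField.mulf /FracField.invf /=.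
  by rewrite !numden_Ratio ?oner_eq0 ?mulr1 ?mul1r.
have nE : n%:F = (fnum f)%:F * (gcdp n d)%:F.
  by rewrite -tofracM /fnum divpK ?dvdp_gcdl.
have dE : d%:F = (fden f)%:F * (gcdp n d)%:F.
  by rewrite -tofracM /fden divpK ?dvdp_gcdr.
by rewrite [LHS]fE nE dE invfM mulrACA mulfV ?mulr1 // dF0.
Qed.

Definition nonconstant (f : ratfun) : Prop := forall c : F, f <> (c%:P)%:F.

(* The numerator of P(x) - Q(y); here x is the outer variable 'X of
   {poly {poly F}} and y the inner one, as in polyXY. *)
Definition Epoly (P Q : ratfun) : {poly {poly F}} :=
  (fnum P)^:P * (fden Q)%:P - (fden P)^:P * (fnum Q)%:P.

(* The projective line over F; None is the point at infinity. *)
Definition sphere := option F.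

(* The value of f at a point of the sphere; at infinity it is the limit of
   fnum f / fden f, i.e. the ratio of the coefficients of degree deg (fden f)
   when deg (fnum f) <= deg (fden f). *)
Definition sph_eval (f : ratfun) (z : sphere) : sphere :=
  match z with
  | Some a =>
      if root (fden f) a then None else Some ((fnum f).[a] / (fden f).[a])
  | None =>
      if (size (fden f) < size (fnum f))%N then None
      else Some ((fnum f)`_(size (fden f)).-1 / lead_coef (fden f))
  end.

(* The order of vanishing of f <> 0 at z, negative at a pole; the local
   coordinate at infinity is 1/x. *)
Definition sph_ord (f : ratfun) (z : sphere) : int :=
  match z with
  | Some a => (mup a (fnum f))%:Z - (mup a (fden f))%:Z
  | None => (size (fden f))%:Z - (size (fnum f))%:Z
  end.

(* The local multiplicity at z of f, seen as a self-map of the sphere: the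
   order of vanishing at z of f - f(z), or of 1/f when f(z) is infinite. *)
Definition local_mult (f : ratfun) (z : sphere) : nat :=
  match sph_eval f z with
  | Some w => absz (sph_ord (f - (w%:P)%:F) z)
  | None => absz (sph_ord f^-1 z)
  end.

Definition is_pole (f : ratfun) (z : sphere) : Prop := sph_eval f z = None.

End RationalFunctions.

(* Main.v *)
(* Let Q = A / B and let U V = P(x) B(y) - A(y).  At a pole of Q of multiplicity
   q, the corresponding valuation v of C(y) has v(B) - v(A) = q > 0, so the
   Newton polygon in x of the right-hand side is the single segment from
   (0, v(A)) to (n, v(A) + q).  By the Gauss lemma for weighted valuations the
   polygon of U is a segment of the same slope q / n, hence n divides
   q * deg_x U.  Taking all the poles, n divides deg_x U, which is therefore 0
   or n; and a factor lying in C[y] divides both A and B, so it is constant. *)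
Require Import Defs.
From mathcomp Require Import all_boot all_order all_algebra.
From mathcomp Require Import reals.
From mathcomp.real_closed Require Import complex.
From mathcomp Require Import zify.

Set Implicit Arguments.
Unset Strict Implicit.
Unset Printing Implicit Defensive.

Local Open Scope ring_scope.

Import Order.TTheory GRing.Theory Num.Theory.

(** * Valuations on an integral domain *)

(** The valuation of 0 would be infinite, which [int] cannot express; [v 0] is left arbitrary and
    every clause is restricted to nonzero elements. *)
Definition valuation (A : idomainType) (v : A -> int) : Prop :=
  (forall a b : A, a != 0 -> b != 0 -> v (a * b) = v a + v b) /\
  (forall a b : A, a != 0 -> b != 0 -> a + b != 0 ->
     Num.min (v a) (v b) <= v (a + b)).

Lemma valuationN (A : idomainType) (v : A -> int) (a : A) :
  valuation v -> v (- a) = v a.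
Proof.
move=> [vM _]; have [->|a0] := eqVneq a 0; first by rewrite oppr0.
have m0 : (-1 : A) != 0 by rewrite oppr_eq0 oner_eq0.
have := vM _ _ m0 m0; rewrite mulrNN mulr1 => v1.
have := vM _ _ (oner_neq0 A) (oner_neq0 A); rewrite mulr1 => v1'.
by rewrite -mulN1r vM //; move: (v 1) (v (-1)) (v a) v1 v1' => *; lia.
Qed.

(** If [v (a + b)] exceeded [v a], then a = (a + b) - b would be a sum of two terms of valuation
    larger than [v a]. The guard on [b] covers b = 0, where [v b] is meaningless. *)
Lemma valuation_dominant (A : idomainType) (v : A -> int) (a b : A) :
  valuation v -> a != 0 -> (b != 0 -> v a < v b) ->
  a + b != 0 /\ v (a + b) = v a.
Proof.
move=> vv a0; have [->|b0 /(_ isT) ltab] := eqVneq b 0; first by rewrite addr0.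
have ab0 : a + b != 0.
  by apply/eqP => /addr0_eq ab; move: ltab; rewrite -ab valuationN // ltxx.
split=> //; apply/eqP; rewrite eq_le; apply/andP; split.
  have := vv.2 (a + b) (- b) ab0; rewrite oppr_eq0 addrK => /(_ b0 a0).
  by rewrite valuationN //; move: (v a) (v b) (v (a + b)) ltab => *; lia.
by have := vv.2 a b a0 b0 ab0; move: (v a) (v b) (v (a + b)) ltab => *; lia.
Qed.

Lemma valuation_sum_gt (A : idomainType) (v : A -> int) (c : int)
    (I : Type) (r : seq I) (p : pred I) (f : I -> A) :
  valuation v -> (forall i, p i -> f i != 0 -> c < v (f i)) ->
  \sum_(i <- r | p i) f i != 0 -> c < v (\sum_(i <- r | p i) f i).
Proof.
move=> vv hf; apply: (big_ind (fun x => x != 0 -> c < v x)) => //.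
  by rewrite eqxx.
move=> x y; have [->|x0] := eqVneq x 0; first by rewrite add0r.
have [->|y0] := eqVneq y 0; first by rewrite addr0 => /(_ isT).
move=> /(_ isT) cx /(_ isT) cy /(vv.2 _ _ x0 y0).
by move: (v x) (v y) (v (x + y)) cx cy => *; lia.
Qed.

(** * Weights and Gauss's lemma *)

(* The weight of the monomial of degree i of U when the variable has
   valuation - q / n, scaled by n to remain an integer. *)
Definition weight {A : idomainType} (v : A -> int) (n q : nat)
    (U : {poly A}) (i : nat) : int := v U`_i *+ n - (q * i)%:Z.

(** Several indices may share the minimal weight; taking the first one in each factor singles out
    one dominant term in a product. *)
Lemma first_min_weight (A : idomainType) (v : A -> int) (n q : nat)
    (U : {poly A}) : U != 0 ->
  exists2 i, U`_i != 0 & forall k, U`_k != 0 ->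
    weight v n q U i <= weight v n q U k /\
    ((k < i)%N -> weight v n q U i < weight v n q U k).
Proof.
move=> U0; have sU : (0 < size U)%N by rewrite size_poly_gt0.
have ltU : ((size U).-1 < size U)%N by rewrite prednK.
have top : U`_(Ordinal ltU) != 0 by rewrite -/(lead_coef U) lead_coef_eq0.
(* As i < size U, this minimises (weight, i) lexicographically. *)
have [i Ui imin] := @arg_minP _ _ _ _ (fun i : 'I_(size U) => U`_i != 0)
  (fun i => weight v n q U i * (size U)%:Z + i%:Z) top.
exists (i : nat) => // k Uk.
have kU : (k < size U)%N.
  by rewrite ltnNge; apply: contra Uk => ?; rewrite nth_default.
have /= := imin (Ordinal kU) Uk; have := ltn_ord i.
move: kU (weight _ _ _ _ _) (weight _ _ _ _ _).
move: (size U) (nat_of_ord i) => s j ks wi wk js le.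
split.
  by have [//|lt] := leP; nia.
by move=> kj; rewrite ltNge; apply/negP => le'; nia.
Qed.

(** Let [i] and [j] be the first indices of minimal weight. Any other term U_l V_(i+j-l) of the
    coefficient i + j has l < i or i + j - l < j, so its weight is strictly larger and U_i V_j
    cannot be cancelled. *)
Lemma weight_mul (A : idomainType) (v : A -> int) (n q : nat)
    (U V : {poly A}) : valuation v -> (0 < n)%N -> U != 0 -> V != 0 ->
  exists i j k, [/\ (U * V)`_k != 0,
    forall l, U`_l != 0 -> weight v n q U i <= weight v n q U l,
    forall l, V`_l != 0 -> weight v n q V j <= weight v n q V l &
    weight v n q (U * V) k = weight v n q U i + weight v n q V j].
Proof.
move=> vv n0 U0 V0; have [vM _] := vv.
have [i Ui imin] := first_min_weight v n q U0.
have [j Vj jmin] := first_min_weight v n q V0.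
exists i, j, (i + j)%N.
have ilt : (i < (i + j).+1)%N by lia.
have UVE : (U * V)`_(i + j) = U`_i * V`_j +
    \sum_(l < (i + j).+1 | l != Ordinal ilt) U`_l * V`_(i + j - l).
  by rewrite coefM (bigD1 (Ordinal ilt)) //= addKn.
have [] := @valuation_dominant _ v (U`_i * V`_j)
  (\sum_(l < (i + j).+1 | l != Ordinal ilt) U`_l * V`_(i + j - l)) vv.
- by rewrite mulf_neq0.
- apply: valuation_sum_gt => // l li.
  rewrite mulf_eq0 negb_or => /andP[Ul Vl]; rewrite !vM //.
  have il : (l : nat) != i by apply: contra li => /eqP li; apply/eqP/val_inj.
  (* The [q] parts of the weights have the same sum along i + j, so comparing weights amounts to
     comparing valuations. *)
  have qE : (q * i + q * j = q * l + q * (i + j - l))%N.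
    by rewrite -!mulnDr subnKC // -ltnS.
  rewrite -(ltr_pMn2r n0) !mulrnDl; have := imin _ Ul; have := jmin _ Vl.
  rewrite /weight; move: il qE (ltn_ord l).
  move: (_ *+ n) (_ *+ n) (_ *+ n) (_ *+ n).
  move: (q * _)%N (q * _)%N (q * _)%N (q * _)%N.
  move: (nat_of_ord l) => *; lia.
rewrite -UVE => UV0 vUV; split=> // [l /imin[]|l /jmin[]|] //.
by rewrite /weight vUV vM // mulrnDl; lia.
Qed.

(** Each end weight of U V is the sum of the corresponding end weights of U and V. By [weight_mul]
    it is at most the sum of their minimal weights, so both ends of each factor attain its
    minimum. *)
Lemma newton_segment_factor (A : idomainType) (v : A -> int) (n q : nat)
    (U V : {poly A}) : valuation v -> (0 < n)%N ->
  (U * V)`_0 != 0 ->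
  (forall i, (U * V)`_i != 0 -> v (U * V)`_0 *+ n <= weight v n q (U * V) i) ->
  v (U * V)`_0 *+ n = weight v n q (U * V) (size (U * V)).-1 ->
  v U`_0 *+ n = weight v n q U (size U).-1.
Proof.
move=> vv n0 E0 Emin Etop; have [vM _] := vv.
have UV0 : U * V != 0 by apply: contraNneq E0 => ->; rewrite coef0.
have /norP[U0 V0] : ~~ ((U == 0) || (V == 0)) by rewrite -mulf_eq0.
have [i [j [k [Ek Umin Vmin Ekw]]]] := weight_mul q vv n0 U0 V0.
have [Ua Va] : U`_0 != 0 /\ V`_0 != 0.
  by move: E0; rewrite coef0M mulf_eq0 => /norP.
have lU : U`_(size U).-1 != 0 by rewrite -/(lead_coef U) lead_coef_eq0.
have lV : V`_(size V).-1 != 0 by rewrite -/(lead_coef V) lead_coef_eq0.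
have wtop : weight v n q (U * V) (size (U * V)).-1 =
    weight v n q U (size U).-1 + weight v n q V (size V).-1.
  rewrite /weight -!lead_coefE lead_coefM vM ?lead_coef_eq0 // mulrnDl.
  have -> : (size (U * V)).-1 = ((size U).-1 + (size V).-1)%N.
    rewrite size_mul //; move: U0 V0; rewrite -!size_poly_gt0.
    by move: (size U) (size V) => *; lia.
  by rewrite mulnDr; move: (v _ *+ n) (v _ *+ n) => *; lia.
have w0 (W : {poly A}) : weight v n q W 0 = v W`_0 *+ n.
  by rewrite /weight muln0 subr0.
move: Etop (Emin _ Ek) (Umin _ Ua) (Vmin _ Va) (Umin _ lU) (Vmin _ lV).
rewrite Ekw wtop !w0 coef0M vM // mulrnDl.
move: (weight _ _ _ _ _) (weight _ _ _ _ _) (weight _ _ _ _ _).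
by move: (weight _ _ _ _ _) (_ *+ n) (_ *+ n) => *; lia.
Qed.

(** * The Newton polygon of P(x) B(y) - A(y) *)

Lemma coef_equation (F : fieldType) (P A B : {poly F}) (i : nat) :
  (P^:P * B%:P - A%:P)`_i = (P`_i)%:P * B - (if i == 0%N then A else 0).
Proof. by rewrite coefB coefMC coef_map coefC. Qed.

Lemma polynomial_equation_factor_degree (F : fieldType)
    (v : {poly F} -> int) (n q : nat) (P : {poly F}) (A B : {poly F})
    (U V : {poly {poly F}}) :
  valuation v -> (forall c : F, c != 0 -> v c%:P = 0) ->
  (0 < n)%N -> size P = n.+1 -> A != 0 -> B != 0 ->
  (0 < q)%N -> v B = v A + q%:Z ->
  U * V = P^:P * B%:P - A%:P -> (n %| q * (size U).-1)%N.
Proof.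
move=> vv vC n0 sP A0 B0 q0 vBA UVE; have [vM _] := vv.
have vPB i : P`_i != 0 -> v ((P`_i)%:P * B) = v A + q%:Z.
  by move=> Pi; rewrite vM ?polyC_eq0 // vC // add0r.
have EiE i : (U * V)`_i = (P`_i)%:P * B - (if i == 0%N then A else 0).
  by rewrite UVE coef_equation.
(* P_0 B is zero or has valuation v A + q > v A, so -A dominates. *)
have [E0 vE0] : (U * V)`_0 != 0 /\ v (U * V)`_0 = v A.
  rewrite EiE eqxx addrC -(valuationN A vv).
  apply: valuation_dominant; rewrite ?oppr_eq0 // valuationN //.
  rewrite mulf_eq0 polyC_eq0 negb_or => /andP[P0 _].
  by rewrite vPB // ltrDl.
have EiS i : (0 < i)%N -> (U * V)`_i = (P`_i)%:P * B.
  by move=> i0; rewrite EiE gtn_eqF // subr0.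
have Pn : P`_n != 0.
  by rewrite -[n]/(n.+1.-1) -sP -lead_coefE lead_coef_eq0 -size_poly_gt0 sP.
have sE : size (U * V) = n.+1.
  rewrite UVE size_polyDl mulrC mul_polyC size_scale ?size_map_polyC //.
  by rewrite size_polyN sP (leq_ltn_trans (size_polyC_leq1 _)).
have qn : q%:Z *+ n = (q * n)%:Z by rewrite -mulr_natr natz -PoszM.
(* At index [n] the excess [q] of v B over v A, scaled by [n], cancels against the slope term q *
   n. *)
have UVtop : v (U * V)`_0 *+ n = weight v n q (U * V) (size (U * V)).-1.
  by rewrite sE vE0 /weight /= EiS // vPB // mulrnDl qn addrK.
have UVmin i : (U * V)`_i != 0 ->
    v (U * V)`_0 *+ n <= weight v n q (U * V) i.
  have [-> _|i0] := posnP i; first by rewrite /weight muln0 subr0.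
  move=> Ei; have le_in : (i <= n)%N.
    by rewrite -ltnS -sE ltnNge; apply: contra Ei => /(nth_default 0) ->.
  move: Ei; rewrite UVtop sE /weight /= !EiS // vPB // => Ei.
  rewrite vPB; last by apply: contraNneq Ei => ->; rewrite mul0r.
  by rewrite lerD2l lerN2 lez_nat leq_mul2l le_in orbT.
have := newton_segment_factor vv n0 E0 UVmin UVtop; rewrite /weight => Ueq.
have : (n%:Z %| (q * (size U).-1)%:Z)%Z.
  (* Equality of the end weights of U says that q * deg U is [n] times this difference. *)
  apply/dvdzP; exists (v U`_(size U).-1 - v U`_0).
  by rewrite -[n%:Z]natz mulr_natr mulrnBl Ueq subKr.
by rewrite /dvdz.
Qed.

(** * Valuations attached to the poles *)

Section RationalFunctions.
Variable F : fieldType.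
Implicit Types (f : {fraction {poly F}}) (P : {poly F}).

Lemma mup_valuation (a : F) : valuation (fun p : {poly F} => (mup a p)%:Z).
Proof.
split=> [p q p0 q0|p q p0 q0 pq0]; first by rewrite mupM.
suff : (minn (mup a p) (mup a q) <= mup a (p + q))%N by lia.
by rewrite mup_geq // dvdp_add // -mup_geq // ?geq_minl ?geq_minr.
Qed.

Lemma mupC (a c : F) : c != 0 -> mup a c%:P = 0%N.
Proof. by move=> c0; apply: mupNroot; rewrite rootC. Qed.

(** This is the valuation at infinity: [1 - size p] is minus the degree of a nonzero [p]. *)
Lemma deg_valuation : valuation (fun p : {poly F} => 1 - (size p)%:Z).
Proof.
split=> [p q p0 q0|p q p0 q0 pq0].
  rewrite size_mul //; move: p0; rewrite -size_poly_gt0.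
  by move: (size p) (size q) => *; lia.
have := size_polyD p q; move: (size p) (size q) (size (p + q)) => *; lia.
Qed.

Lemma eq_fnum_fden f (a b : {poly F}) :
  b != 0 -> f = a%:F / b%:F -> fnum f * b = a * fden f.
Proof.
move=> b0; rewrite [in LHS](fnum_fdenE f) => /eqP.
rewrite eqr_div ?tofrac_eq0 ?fden_neq0 // -!tofracM tofrac_eq.
by move/eqP.
Qed.

Lemma fnum_neq0 f : f != 0 -> fnum f != 0.
Proof.
by apply: contraNneq => f0; rewrite (fnum_fdenE f) f0 tofrac0 mul0r.
Qed.

(** Inverting [f] swaps its reduced numerator and denominator only up to a constant, as they depend
    on the chosen representative; this identity suffices to compare orders. *)
Lemma fnum_fdenV f : f != 0 -> fnum f^-1 * fnum f = fden f * fden f^-1.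
Proof.
move=> f0; apply: eq_fnum_fden; first exact: fnum_neq0.
by rewrite {1}(fnum_fdenE f) invf_div.
Qed.

Lemma pole_valuation f (z : sphere F) : f != 0 -> is_pole f z ->
  exists v : {poly F} -> int, [/\ valuation v,
    forall c : F, c != 0 -> v c%:P = 0,
    (0 < local_mult f z)%N &
    v (fden f) = v (fnum f) + (local_mult f z)%:Z].
Proof.
move=> f0 pz; rewrite /local_mult (pz : sph_eval f z = None).
have N0 := fnum_neq0 f0; have D0 := fden_neq0 f.
have N'0 : fnum f^-1 != 0 by apply: fnum_neq0; rewrite invr_eq0.
have D'0 := fden_neq0 f^-1; have ND := fnum_fdenV f0.
case: z pz => [a|]; rewrite /is_pole /=.
- case: ifP => // rD _; exists (fun p => (mup a p)%:Z).
  have rN : ~~ root (fnum f) a.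
    apply/negP => rN; have := coprimep_root (coprime_fnum_fden f) rN.
    by rewrite -rootE rD.
  have mN := mupNroot rN.
  have mD : (0 < mup a (fden f))%N by rewrite -XsubC_dvd // dvdp_XsubCl.
  (* Since [fnum f] does not vanish at [a], the order of 1/f there is the multiplicity of [a] in
     [fden f]. *)
  have := congr1 (mup a) ND; rewrite !mupM // mN addn0 => ->.
  by split; [exact: mup_valuation|move=> c c0; rewrite mupC|lia|lia].
- case: ifP => // ltDN _; exists (fun p => 1 - (size p)%:Z).
  have := congr1 (fun p : {poly F} => size p) ND; rewrite !size_mul //.
  move: N0 N'0 D0 D'0 ltDN; rewrite -!size_poly_gt0.
  move: (size (fnum f)) (size (fden f)) (size (fnum f^-1)) (size (fden f^-1)).
  move=> *.
  split; [exact: deg_valuation| |lia|lia].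
  by move=> c c0; rewrite size_polyC c0.
Qed.

(** The reduced denominator of a polynomial divides the reduced numerator, so by coprimality it is a
    constant [d]. *)
Lemma Epoly_polynomial P f : exists (P' : {poly F}) (d : F),
  [/\ d != 0, size P' = size P &
    Epoly P%:F f = P'^:P * (fden f)%:P - (d *: fnum f)%:P].
Proof.
have PE : P%:F = P%:F / (1 : {poly F})%:F by rewrite tofrac1 divr1.
have := eq_fnum_fden (oner_neq0 _) PE; rewrite mulr1 => NE.
have dvdDN : fden P%:F %| fnum P%:F by rewrite NE dvdp_mull.
have := coprimepP _ _ (coprime_fnum_fden P%:F) _ dvdDN (dvdpp _).
rewrite -size_poly_eq1 => /size_poly1P[d d0 dE].
exists (fnum P%:F), d; split=> //.
  by rewrite NE dE mulrC mul_polyC size_scale.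
by rewrite /Epoly dE map_polyC /= -polyCM mul_polyC.
Qed.

End RationalFunctions.

(** * Combining the poles and excluding factors free of x *)

Lemma dvdn_big_gcdn_mul (I : eqType) (s : seq I) (f : I -> nat) (n r : nat) :
  (forall i, i \in s -> n %| f i * r)%N ->
  (n %| \big[gcdn/0%N]_(i <- s) f i * r)%N.
Proof.
move=> h; rewrite big_seq; apply: (big_ind (fun m => n %| m * r)%N) => //.
by move=> a b ha hb; rewrite muln_gcdl dvdn_gcd ha.
Qed.

Lemma unit_of_size1_factor (F : fieldType) (P A B : {poly F})
    (U V : {poly {poly F}}) :
  (1 < size P)%N -> coprimep A B -> U * V = P^:P * B%:P - A%:P ->
  size U = 1%N -> U \is a GRing.unit.
Proof.
move=> sP cAB UVE /eqP/size_poly1P[u u0 UE].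
have udvd i : u %| (P`_i)%:P * B - (if i == 0%N then A else 0).
  by rewrite -coef_equation -UVE UE coefCM dvdp_mulr.
have lP : P`_(size P).-1 != 0.
  by rewrite -lead_coefE lead_coef_eq0 -size_poly_gt0; case: (size P) sP.
have uB : u %| B.
  (* The top index is positive, so A does not enter this coefficient, which is a nonzero scalar
     times B. *)
  have := udvd (size P).-1; rewrite gtn_eqF ?subr0; last by case: (size P) sP.
  by rewrite mul_polyC dvdpZr.
have uA : u %| A.
  by have := udvd 0%N; rewrite eqxx dvdp_addr ?dvdp_mull // dvdpNr.
have := coprimepP _ _ cAB u uA uB; rewrite UE -size_poly_eq1.
move=> /size_poly1P [c c0 ->].
by rewrite !rmorph_unit ?unitfE.
Qed.

Theorem theorem3p5 (R : realType) (n : nat) (P : {poly R[i]})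
    (Q : {fraction {poly R[i]}}) (poles : seq (sphere R[i])) :
  (1 <= n)%N -> size P = n.+1 ->
  nonconstant Q ->
  uniq poles -> (forall z : sphere R[i], z \in poles <-> is_pole Q z) ->
  gcdn (\big[gcdn/0%N]_(z <- poles) local_mult Q z) n = 1%N ->
  irreducible_elt (Epoly P%:F Q).
Proof.
move=> n0 sP Qnc _ polesP gcd1.
have Q0 : Q != 0 by apply/eqP => Q0; apply: (Qnc 0); rewrite Q0 tofrac0.
have [P' [d [d0 sP' ->]]] := Epoly_polynomial P Q.
set A := d *: fnum Q; set B := fden Q; set E := _ - _.
have A0 : A != 0 by rewrite scaler_eq0 negb_or d0 fnum_neq0.
have B0 : B != 0 by exact: fden_neq0.
have cAB : coprimep A B by rewrite coprimepZl // coprime_fnum_fden.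
have sE : size E = n.+1.
  rewrite size_polyDl mulrC mul_polyC size_scale ?size_map_polyC ?sP' ?sP //.
  by rewrite size_polyN (leq_ltn_trans (size_polyC_leq1 _)).
have sP'1 : (1 < size P')%N by rewrite sP' sP.
split=> [||U V EUV].
- by rewrite -size_poly_gt0 sE.
- by rewrite poly_unitE sE eqSS eqn0Ngt n0.
have := @dvdn_big_gcdn_mul _ poles (local_mult Q) n (size U).-1.
have /[swap]/[apply] : forall z, z \in poles ->
    (n %| local_mult Q z * (size U).-1)%N.
  move=> z /polesP pz; have [v [vv vC q0 vq]] := pole_valuation Q0 pz.
  apply: (polynomial_equation_factor_degree vv vC n0 _ A0 B0 q0 _ (esym EUV)).
    by rewrite sP'.
  (* The scalar [d] hidden in [A] has valuation 0. *)
  by rewrite vq /A -mul_polyC vv.1 ?polyC_eq0 ?fnum_neq0 // vC // add0r.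
move=> h.
(* Multiply gcd(q_1, ..., q_l, n) = 1 by deg U: [n] divides the gcd of the q_i times deg U, and n *
   deg U trivially. *)
have nU : (n %| (size U).-1)%N.
  by rewrite -[(size U).-1]mul1n -gcd1 muln_gcdl dvdn_gcd h dvdn_mulr.
have UV0 : U * V != 0 by rewrite -EUV -size_poly_gt0 sE.
have /norP[U0 V0] : ~~ ((U == 0) || (V == 0)) by rewrite -mulf_eq0.
have sUV : (size U + size V = n.+2)%N.
  have := sE; rewrite EUV size_mul //; move: U0 V0.
  by rewrite -!size_poly_gt0; lia.
(* Either deg U = 0, or deg U >= n and deg V = 0 because the degrees add up to [n]. *)
have [U1|U1] := posnP (size U).-1; [left|right].
  apply: (unit_of_size1_factor sP'1 cAB (esym EUV)).
  by move: U0 U1; rewrite -size_poly_gt0; move: (size U) => k; lia.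
have UVC : V * U = E by rewrite mulrC.
apply: (unit_of_size1_factor sP'1 cAB UVC).
by move: (dvdn_leq U1 nU) V0 sUV; rewrite -size_poly_gt0;
  move: (size U) (size V) => *; lia.
Qed.
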